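(* Let $(G,S)$ and $(H,S')$ be two recursively presented marked groups, and suppose that $(H,S')$ is a strict marked quotient of $(G,S)$. Then no algorithm that takes as input recursive presentations of either $(G,S)$ or $(H,S')$ can stop exactly on the presentations that define $(G,S)$. That is, there is no partial computable function $F:\subseteq\mathbb{N}\to\mathbb{N}$ such that for every $p\in\mathbb{N}$ with $\nu_{RP}(p)\in\{(G,S),(H,S')\}$, $F(p)$ is defined if and only if $\nu_{RP}(p)=(G,S)$.
   Context: A $k$-marked group is a pair $(G,S)$ with $G$ a group and $S=(s_1,\dots,s_k)\in G^k$ a tuple generating $G$. A morphism of $k$-marked groups $(G,S)\to(H,S')$ is a group homomorphism sending $s_i$ to $s_i'$ for each $i$. Marked groups are considered up to isomorphism of marked groups, so equality of marked groups means isomorphism as marked groups. $(H,S')$ is a marked quotient of $(G,S)$ if there is a morphism $(G,S)\to(H,S')$; it is a strict marked quotient if moreover the two are not isomorphic as marked groups. Groups marked by tuples of different lengths are incomparable. Let $\langle n,m\rangle$ denote a computable bijection $\mathbb{N}^2\to\mathbb{N}$ with computable inverse. Let $\mathcal{A}_n=\{x_1,\dots,x_n\}$ and let $\theta_n:\mathbb{N}\to(\mathcal{A}_n\cup\mathcal{A}_n^{-1})^*$ be a natural computable bijection (e.g. shortlex order), uniformly in $n\geq 1$. Let $\varphi_0,\varphi_1,\dots$ be a standard enumeration of the partial computable functions and $W_i=\mathrm{dom}(\varphi_i)$. The numbering of recursive presentations is $\nu_{RP}(\langle n,i\rangle)=\langle\mathcal{A}_n\mid\theta_n(W_i)\rangle$,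 marked by $(x_1,\dots,x_n)$. A marked group is recursively presented if it is in the image of $\nu_{RP}$; an integer $p$ with $\nu_{RP}(p)=(G,S)$ is (a code of) a recursive presentation of $(G,S)$. *)

(* Defs.v *)
From HB Require Import structures.
From mathcomp Require Import all_boot.
From mathcomp Require Import boolp classical_sets.
From Stdlib Require Cantor.

Set Implicit Arguments.
Unset Strict Implicit.
Unset Printing Implicit Defensive.

Local Open Scope nat_scope.

Definition pairn (x y : nat) : nat := Cantor.to_nat (x, y).
Definition fstn (z : nat) : nat := (Cantor.of_nat z).1.
Definition sndn (z : nat) : nat := (Cantor.of_nat z).2.

(** Programs for the partial recursive functions of one variable; several
    arguments are passed through [pairn]. *)
Inductive code : Type :=
  | CZero | CSucc | CFst | CSnd
  | CPair of code & code
  | CComp of code & code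
  | CPrec of code & code
  | CMu of code.

Fixpoint prec_graph (f g : nat -> nat -> Prop) (a n : nat) : nat -> Prop :=
  if n is n'.+1 then
    fun z => exists2 y, prec_graph f g a n' y & g (pairn a (pairn n' y)) z
  else f a.

(** [eval c x y]: the program [c] halts on the input [x] with output [y].
    In particular [CMu f] searches for the least [y] with [f (x, y) = 0] and
    requires [f (x, m)] to be defined for all [m < y]. *)
Fixpoint eval (c : code) : nat -> nat -> Prop :=
  match c with
  | CZero => fun _ y => y = 0
  | CSucc => fun x y => y = x.+1
  | CFst => fun x y => y = fstn x
  | CSnd => fun x y => y = sndn x
  | CPair f g => fun x y =>
      exists u v, [/\ eval f x u, eval g x v & y = pairn u v]
  | CComp f g => fun x y => exists2 u, eval g x u & eval f u y
  | CPrec f g => fun x => prec_graph (eval f) (eval g) (fstn x) (sndn x)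
  | CMu f => fun x y =>
      eval f (pairn x y) 0 /\
      forall m, m < y -> exists v, eval f (pairn x m) v.+1
  end.

(** Partial functions are represented by their graphs; see [eval_functional]. *)
Definition partial_computable (F : nat -> nat -> Prop) : Prop :=
  exists c, forall x y, F x y <-> eval c x y.

Definition defined (F : nat -> nat -> Prop) (x : nat) : Prop := exists y, F x y.

Fixpoint encode (c : code) : nat :=
  match c with
  | CZero => 0
  | CSucc => 1
  | CFst => 2
  | CSnd => 3
  | CPair f g => 4 + 4 * pairn (encode f) (encode g)
  | CComp f g => 5 + 4 * pairn (encode f) (encode g)
  | CPrec f g => 6 + 4 * pairn (encode f) (encode g)
  | CMu f => 7 + 4 * encode f
  end.

(** [encode] is a bijection (see [encode_inj], [encode_surj]), so [phi i] is
    the function computed by the unique program of Goedel number [i]. *)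
Definition phi (i : nat) : nat -> nat -> Prop :=
  fun x y => exists2 c, encode c = i & eval c x y.

Definition W (i : nat) : set nat := [set x | defined (phi i) x]%classic.

Lemma eval_functional c x y z : eval c x y -> eval c x z -> y = z.
Proof.
elim: c x y z => [||||f IHf g IHg|f IHf g IHg|f IHf g IHg|f IHf] x y z /=.
- by move=> -> ->.
- by move=> -> ->.
- by move=> -> ->.
- by move=> -> ->.
- move=> [u [v [hu hv ->]]] [u' [v' [hu' hv' ->]]].
  by rewrite (IHf _ _ _ hu hu') (IHg _ _ _ hv hv').
- move=> [u hu hy] [u' hu' hz].
  by move: hy; rewrite (IHg _ _ _ hu hu') => hy; apply: IHf hy hz.
- elim: (sndn x) y z => [|n IHn] y z /=; first exact: IHf.
  move=> [u hu hy] [u' hu' hz].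
  by move: hy; rewrite (IHn _ _ hu hu') => hy; apply: IHg hy hz.
- move=> [hy my] [hz mz]; case: (ltngtP y z) => // h.
  + by have [v hv] := mz _ h; have := IHf _ _ _ hy hv.
  + by have [v hv] := my _ h; have := IHf _ _ _ hz hv.
Qed.

Lemma pairn_inj x y x' y' : pairn x y = pairn x' y' -> x = x' /\ y = y'.
Proof.
move=> /(congr1 Cantor.of_nat).
by rewrite /pairn !Cantor.cancel_of_to => -[-> ->].
Qed.

Lemma fstn_sndn z : pairn (fstn z) (sndn z) = z.
Proof. by rewrite /pairn /fstn /sndn -surjective_pairing Cantor.cancel_to_of. Qed.

Lemma leq_fstn_sndn z : fstn z <= z /\ sndn z <= z.
Proof.
have := Cantor.to_nat_non_decreasing (fstn z) (sndn z).
rewrite -/(pairn _ _) fstn_sndn => /leP h.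
by split; apply: leq_trans h; [exact: leq_addl | exact: leq_addr].
Qed.

Lemma encode_inj : injective encode.
Proof.
have aux a b m n : a < 4 -> b < 4 -> a + 4 * m = b + 4 * n -> a = b /\ m = n.
  move=> ha hb h.
  have e1 : (a + 4 * m) %% 4 = a by rewrite addnC mulnC modnMDl modn_small.
  have e2 : (b + 4 * n) %% 4 = b by rewrite addnC mulnC modnMDl modn_small.
  have e : a = b by rewrite -e1 h e2.
  by split=> //; move: h; rewrite e => /addnI /eqP; rewrite eqn_pmul2l // => /eqP.
have step a b m n : a < 4 -> b < 4 ->
    4 + a + 4 * m = 4 + b + 4 * n -> a = b /\ m = n.
  by move=> ha hb; rewrite -!addnA => /addnI; apply: aux.
have p2 f g f' g' a b : a < 4 -> b < 4 ->
    4 + a + 4 * pairn f g = 4 + b + 4 * pairn f' g' ->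
    [/\ a = b, f = f' & g = g'].
  by move=> ha hb /(step _ _ _ _ ha hb)[-> /pairn_inj[-> ->]].
elim=> [||||f IHf g IHg|f IHf g IHg|f IHf g IHg|f IHf]
       [||||f' g'|f' g'|f' g'|f'] //=.
- by case/(@p2 _ _ _ _ 0 0) => // _ /IHf-> /IHg->.
- by case/(@p2 _ _ _ _ 0 1).
- by case/(@p2 _ _ _ _ 0 2).
- by case/(@step 0 3).
- by case/(@p2 _ _ _ _ 1 0).
- by case/(@p2 _ _ _ _ 1 1) => // _ /IHf-> /IHg->.
- by case/(@p2 _ _ _ _ 1 2).
- by case/(@step 1 3).
- by case/(@p2 _ _ _ _ 2 0).
- by case/(@p2 _ _ _ _ 2 1).
- by case/(@p2 _ _ _ _ 2 2) => // _ /IHf-> /IHg->.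
- by case/(@step 2 3).
- by case/(@step 3 0).
- by case/(@step 3 1).
- by case/(@step 3 2).
- by case/(@step 3 3) => // _ /IHf->.
Qed.

Lemma encode_surj i : exists c, encode c = i.
Proof.
elim/ltn_ind: i => i IH; have [i4|i4] := ltnP i 4.
  by case: i i4 {IH} => [|[|[|[|//]]]] _;
    [exists CZero | exists CSucc | exists CFst | exists CSnd].
set q := (i - 4) %/ 4; set r := (i - 4) %% 4.
have qi : q < i.
  by apply: leq_ltn_trans (leq_div _ _) _; rewrite ltn_subrL (leq_trans _ i4).
have Ei : 4 + r + 4 * q = i.
  by rewrite -addnA (addnC r) mulnC -divn_eq subnKC.
have [qf qs] := leq_fstn_sndn q.
have [f Ef] := IH _ (leq_ltn_trans qf qi).
have [g Eg] := IH _ (leq_ltn_trans qs qi).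
have [h Eh] := IH _ qi.
have : r < 4 by rewrite ltn_mod.
case: r Ei => [|[|[|[|//]]]] Ei _.
- by exists (CPair f g); rewrite /= Ef Eg fstn_sndn.
- by exists (CComp f g); rewrite /= Ef Eg fstn_sndn.
- by exists (CPrec f g); rewrite /= Ef Eg fstn_sndn.
- by exists (CMu h); rewrite /= Eh.
Qed.

(** The letter [(i, false)] is [x_(i+1)] and [(i, true)] is its inverse. *)
Notation letter n := ('I_n * bool)%type.
Notation word n := (seq (letter n)).

Definition inv_letter n (l : letter n) : letter n := (l.1, ~~ l.2).

(** Letters are ordered x_1 < x_1^-1 < x_2 < x_2^-1 < ... *)
Definition nth_letter n (a : nat) : letter n.+1 := (inord a./2, odd a).

(** The [m]-th word in shortlex order is the bijective base-[2n] numeral of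
    [m], most significant digit first; [fuel >= m] suffices. *)
Fixpoint theta_rec n (fuel m : nat) : word n.+1 :=
  match fuel, m with
  | fuel'.+1, m'.+1 =>
      rcons (theta_rec n fuel' (m' %/ n.+1.*2)) (nth_letter n (m' %% n.+1.*2))
  | _, _ => [::]
  end.

(** On the empty alphabet there is only the empty word. *)
Definition theta (n : nat) : nat -> word n :=
  if n is n'.+1 then fun m => theta_rec n' m m else fun _ => [::].

Definition letter_rank n (l : letter n) : nat := l.1.*2 + l.2.
Definition word_rank n (w : word n) : nat :=
  foldl (fun m l => (m * n.*2 + letter_rank l).+1) 0 w.

Lemma theta_bij n : 0 < n -> bijective (@theta n).
Proof.
case: n => // n _; pose k := n.+1.*2.
have nthK a : a < k -> letter_rank (nth_letter n a) = a.
  move=> ak; rewrite /letter_rank /= inordK; last first.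
    by rewrite -ltn_double (leq_ltn_trans _ ak) // -{2}(odd_double_half a) leq_addl.
  by rewrite addnC odd_double_half.
have rankK (l : letter n.+1) : nth_letter n (letter_rank l) = l.
  case: l => i b; rewrite /letter_rank /nth_letter /=.
  by rewrite oddD odd_double /= oddb addnC half_bit_double inord_val.
have rank_lt (l : letter n.+1) : letter_rank l < k.
  case: l => i b; rewrite /letter_rank /k /= doubleS.
  apply: (@leq_ltn_trans (n.*2 + b)); first by rewrite leq_add2r leq_double -ltnS.
  by case: b; rewrite ?addn1 ?addn0.
have recK f m : m <= f -> word_rank (theta_rec n f m) = m.
  elim: f m => [|f IH] [|m] //= mf.
  rewrite /word_rank foldl_rcons -/(word_rank _) nthK ?ltn_mod //.
  by rewrite IH -?divn_eq // (leq_trans (leq_div _ _)).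
have rankW (w : word n.+1) f : word_rank w <= f -> theta_rec n f (word_rank w) = w.
  elim/last_ind: w f => [|w l IH] [|f]; rewrite ?/word_rank ?foldl_rcons -/(word_rank _) //=.
  move=> h; rewrite divnMDl // divn_small // addn0 modnMDl modn_small // rankK.
  rewrite IH //; apply: leq_trans (h : _ <= f).
  by rewrite (leq_trans _ (leq_addr _ _)) // leq_pmulr.
by exists (@word_rank n.+1) => [m|w]; [apply: recK | apply: rankW].
Qed.

(** The congruence on words generated by free cancellation and by the
    relators [R]. *)
Inductive pres_eq n (R : set (word n)) : word n -> word n -> Prop :=
  | pres_refl u : pres_eq R u u
  | pres_sym u v : pres_eq R u v -> pres_eq R v u
  | pres_trans u v w : pres_eq R u v -> pres_eq R v w -> pres_eq R u w
  | pres_cat u u' v v' :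
      pres_eq R u u' -> pres_eq R v v' -> pres_eq R (u ++ v) (u' ++ v')
  | pres_cancel l : pres_eq R [:: l; inv_letter l] [::]
  | pres_rel r : R r -> pres_eq R r [::].

Section Presentation.
Variables (n : nat) (R : set (word n)).

Definition pres_rel_b (u v : word n) : bool := `[< pres_eq R u v >].

Lemma pres_rel_b_refl : reflexive pres_rel_b.
Proof. by move=> u; apply/asboolP; exact: pres_refl. Qed.

Lemma pres_rel_b_sym : symmetric pres_rel_b.
Proof. by move=> u v; apply/asboolP/asboolP => /pres_sym. Qed.

Lemma pres_rel_b_trans : transitive pres_rel_b.
Proof.
move=> v u w /asboolP uv /asboolP vw; apply/asboolP; exact: pres_trans uv vw.
Qed.

Canonical pres_equiv :=
  EquivRel pres_rel_b pres_rel_b_refl pres_rel_b_sym pres_rel_b_trans.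

Definition presented := {eq_quot pres_equiv}%qT.

HB.instance Definition _ := Choice.on presented.

Definition pres_class (w : word n) : presented := (\pi_presented w)%qT.

Lemma pres_classP u v : pres_class u = pres_class v <-> pres_eq R u v.
Proof. by split=> [/eqmodP/asboolP|h]; last exact/eqmodP/asboolP. Qed.

Lemma pres_class_repr (x : presented) : pres_class (repr x) = x.
Proof. exact: reprK. Qed.

Definition inv_word (w : word n) : word n := rev (map (@inv_letter n) w).

Definition pres_one : presented := pres_class [::].
Definition pres_mul (x y : presented) : presented :=
  pres_class (repr x ++ repr y).
Definition pres_inv (x : presented) : presented :=
  pres_class (inv_word (repr x)).

Lemma pres_repr w : pres_eq R (repr (pres_class w)) w.
Proof. by apply/pres_classP; rewrite pres_class_repr. Qed.

Lemma pres_mulE u v : pres_mul (pres_class u) (pres_class v) = pres_class (u ++ v).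
Proof. by apply/pres_classP; apply: pres_cat; exact: pres_repr. Qed.

Lemma pres_word_mulV w : pres_eq R (w ++ inv_word w) [::].
Proof.
elim: w => [|l w IH]; first exact: pres_refl.
rewrite /inv_word /= rev_cons -cats1 -/(inv_word w).
apply: (pres_trans (v := [:: l] ++ [:: inv_letter l])); last exact: pres_cancel.
apply: (pres_cat (pres_refl R [:: l])); rewrite catA.
exact: (pres_cat IH (pres_refl R [:: inv_letter l])).
Qed.

Lemma inv_wordK : involutive inv_word.
Proof.
move=> w; rewrite /inv_word map_rev revK -map_comp -[RHS]map_id.
by apply: eq_map => -[i b]; rewrite /inv_letter /= negbK.
Qed.

Lemma pres_mulA : associative pres_mul.
Proof.
move=> x y z; rewrite -(pres_class_repr x) -(pres_class_repr y).
by rewrite -(pres_class_repr z) !pres_mulE catA.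
Qed.

Lemma pres_mul1 : left_id pres_one pres_mul.
Proof. by move=> x; rewrite -(pres_class_repr x) pres_mulE. Qed.

Lemma pres_mulr1 : right_id pres_one pres_mul.
Proof. by move=> x; rewrite -(pres_class_repr x) pres_mulE cats0. Qed.

Lemma pres_mulV : right_inverse pres_one pres_inv pres_mul.
Proof.
move=> x; rewrite -{1}(pres_class_repr x) pres_mulE.
by apply/pres_classP; exact: pres_word_mulV.
Qed.

Lemma pres_mulVr : left_inverse pres_one pres_inv pres_mul.
Proof.
move=> x; rewrite -{2}(pres_class_repr x) pres_mulE.
apply/pres_classP; rewrite -{2}(inv_wordK (repr x)); exact: pres_word_mulV.
Qed.

HB.instance Definition _ := isGroup.Build presented
  pres_mulA pres_mul1 pres_mulr1 pres_mulVr pres_mulV.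

Definition pres_gens : n.-tuple presented :=
  [tuple pres_class [:: (i, false)] | i < n].

End Presentation.

Definition generates (G : groupType) (s : seq G) : Prop :=
  forall P : {pred G}, group_closed P -> {subset s <= P} -> forall x, x \in P.

Record markedGroup : Type := MarkedGroup {
  mg_rank : nat;
  mg_group :> groupType;
  mg_marking : mg_rank.-tuple mg_group;
  mg_generates : generates mg_marking
}.

(** Comparing the markings as sequences also forces the ranks to agree. *)
Definition marked_morphism (G H : markedGroup) (f : G -> H) : Prop :=
  {morph f : x y / (x * y)%g} /\ map f (mg_marking G) = mg_marking H.

Definition marked_iso (G H : markedGroup) : Prop :=
  exists2 f : G -> H, marked_morphism f & bijective f.

Definition marked_quotient (H G : markedGroup) : Prop :=
  exists f : G -> H, marked_morphism f.

Definition strict_marked_quotient (H G : markedGroup) : Prop :=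
  marked_quotient H G /\ ~ marked_iso G H.

Lemma pres_generates n (R : set (word n)) : generates (pres_gens R).
Proof.
move=> P Pgrp sP x; rewrite -(pres_class_repr x).
have [P1 _] := Pgrp.
have gen i : pres_class R [:: (i, false)] \in P.
  by apply: sP; apply/tnthP; exists i; rewrite tnth_mktuple.
elim: (repr x) => [//|[i b] w IH].
rewrite -cat1s -pres_mulE; apply: (group_closedM Pgrp) => //.
case: b => //; have -> : pres_class R [:: (i, true)] = (pres_class R [:: (i, false)])^-1%g.
  apply: (@mulIg _ (pres_class R [:: (i, false)])); rewrite mulVg.
  rewrite [LHS]pres_mulE; apply/pres_classP; exact: (pres_cancel R (i, true)).
exact: (group_closedV Pgrp).
Qed.

Definition presentation n (R : set (word n)) : markedGroup :=
  MarkedGroup (@pres_generates n R).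

Definition nuRP (p : nat) : markedGroup :=
  presentation (@theta (fstn p) @` W (sndn p))%classic.

Definition recursively_presented (G : markedGroup) : Prop :=
  exists p, marked_iso (nuRP p) G.

(* Main.v *)
(** Let [W_g] and [W_h] enumerate relators of [G] and [H] on the same alphabet
    of size [n].  If [F] existed, the recursion theorem would give an index [e]
    with [W_e = W_g] when [F <n, e>] diverges and [W_e = W_g `|` W_h] when it
    converges.  As [H] is a quotient of [G], the presentation [<n, e>] defines
    [G] in the first case and [H] in the second, the opposite of what [F]
    reports.  The recursion theorem only needs the s-m-n function; enumerating
    the union of two domains needs an evaluator cut off after [t] steps, built
    separately for each program, so no universal program is required. *)

Require Import Defs.
From mathcomp Require Import all_boot.
From mathcomp Require Import boolp classical_sets.
From Stdlib Require Cantor.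

Set Implicit Arguments.
Unset Strict Implicit.
Unset Printing Implicit Defensive.

(** * Closure properties of total computable functions *)

Lemma fstn_pairn x y : fstn (pairn x y) = x.
Proof. by rewrite /fstn /pairn Cantor.cancel_of_to. Qed.

Lemma sndn_pairn x y : sndn (pairn x y) = y.
Proof. by rewrite /sndn /pairn Cantor.cancel_of_to. Qed.

Definition pairnE := (fstn_pairn, sndn_pairn).

Definition computable (f : nat -> nat) : Prop :=
  exists c, forall x y, eval c x y <-> y = f x.

Lemma eq_computable f g : f =1 g -> computable f -> computable g.
Proof. by move=> fg [c hc]; exists c => x y; rewrite -fg. Qed.

Lemma computable_fst : computable fstn.
Proof. by exists CFst. Qed.

Lemma computable_snd : computable sndn.
Proof. by exists CSnd. Qed.

Lemma computable_succ : computable succn.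
Proof. by exists CSucc. Qed.

Lemma computable_comp f g :
  computable f -> computable g -> computable (fun x => f (g x)).
Proof.
move=> [cf hf] [cg hg]; exists (CComp cf cg) => x y /=; split.
  by move=> [u /hg -> /hf].
by move=> ->; exists (g x); [apply/hg | apply/hf].
Qed.

Lemma computable_pair f g :
  computable f -> computable g -> computable (fun x => pairn (f x) (g x)).
Proof.
move=> [cf hf] [cg hg]; exists (CPair cf cg) => x y /=; split.
  by move=> [u [v [/hf -> /hg ->]]].
by move=> ->; exists (f x), (g x); split=> //; [apply/hf | apply/hg].
Qed.

Lemma computable_id : computable id.
Proof.
apply: (eq_computable fstn_sndn).
exact: computable_pair computable_fst computable_snd.
Qed.

Fixpoint CConst (k : nat) : code :=
  if k is k'.+1 then CComp CSucc (CConst k') else CZero.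

Lemma eval_const k x y : eval (CConst k) x y <-> y = k.
Proof.
elim: k y => [|k IH] y //=; split; first by move=> [u /IH-> ->].
by move=> ->; exists k => //; apply/IH.
Qed.

Lemma computable_const k : computable (fun=> k).
Proof. exists (CConst k) => x y; exact: eval_const. Qed.

(** [CPrec] takes its parameter and its counter from one pair. Precomposing with [pairn x (n x)]
    allows any computable counter and keeps all of [x] visible to the step. *)
Lemma computable_rec n a b :
    computable n -> computable a -> computable b ->
  computable (fun x => nat_rec (fun=> nat) (a x)
    (fun m y => b (pairn x (pairn m y))) (n x)).
Proof.
move=> hn [ca ha] [cb hb].
apply: (@eq_computable (fun x => (fun z => nat_rec (fun=> nat) (a (fstn z))
    (fun m y => b (pairn (fstn z) (pairn m y))) (sndn z)) (pairn x (n x)))).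
  by move=> x /=; rewrite !pairnE.
apply: (computable_comp (f := fun z => nat_rec (fun=> nat) (a (fstn z))
    (fun m y => b (pairn (fstn z) (pairn m y))) (sndn z)));
  last exact: computable_pair computable_id hn.
exists (CPrec ca cb) => z y /=; elim: (sndn z) y => [|m IH] y //=.
split; first by move=> [u /IH-> /hb].
by move=> ->; eexists; [apply/IH | apply/hb].
Qed.

(** A case distinction is a primitive recursion whose step discards the previous value. *)
Lemma computable_case n a b :
    computable n -> computable a -> computable b ->
  computable (fun x => if n x is m.+1 then b (pairn x m) else a x).
Proof.
move=> hn ha hb.
pose b' w := b (pairn (fstn w) (fstn (sndn w))).
have hb' : computable b'.
  apply: (computable_comp hb); apply: computable_pair computable_fst _.
  exact: computable_comp computable_fst computable_snd.
apply: eq_computable (computable_rec hn ha hb') => x.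
by case: (n x) => [|m] //=; rewrite /b' !pairnE.
Qed.

Lemma computable_if n a b :
    computable n -> computable a -> computable b ->
  computable (fun x => if n x is _.+1 then b x else a x).
Proof.
move=> hn ha hb; have hb' := computable_comp hb computable_fst.
apply: eq_computable (computable_case hn ha hb') => x.
by case: (n x) => [|m] //; rewrite pairnE.
Qed.

Lemma computable_pred : computable predn.
Proof.
apply: eq_computable (computable_case computable_id (computable_const 0) computable_snd).
by case=> [|m] //; rewrite pairnE.
Qed.

Lemma computable_add f g :
  computable f -> computable g -> computable (fun x => f x + g x).
Proof.
move=> hf hg.
have hb : computable (fun w => (sndn (sndn w)).+1).
  apply: computable_comp computable_succ _.
  exact: computable_comp computable_snd computable_snd.
apply: eq_computable (computable_rec hf hg hb) => x.
by elim: (f x) => [|m IH] //=; rewrite !pairnE IH.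
Qed.

Lemma computable_muln k f : computable f -> computable (fun x => k * f x).
Proof.
move=> hf; elim: k => [|k IH].
  by apply: eq_computable (computable_const 0) => x; rewrite mul0n.
by apply: eq_computable (computable_add hf IH) => x; rewrite mulSn.
Qed.

(** * Evaluation with a bound on unbounded searches *)

(** Unbounded search with [k] steps: the counter stays put once the test [h] is
    zero or undefined. *)
Definition scan (h : nat -> option nat) (k : nat) : nat :=
  iter k (fun m => if h m is Some _.+1 then m.+1 else m) 0.

Lemma lt_scan h k j : j < scan h k -> exists v, h j = Some v.+1.
Proof.
rewrite /scan; elim: k => [|k IH] //=.
case E: (h _) => [[|v]|] /=; try exact: IH.
by rewrite ltnS leq_eqVlt => /predU1P[->|//]; exists v.
Qed.

Lemma scan_stop h y k : h y = Some 0 ->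
  (forall m, m < y -> exists v, h m = Some v.+1) -> y <= k -> scan h k = y.
Proof.
(* Writing [y] as [minn k y] gives a statement that also covers the counters before [y] is reached,
   so induction on [k] applies. *)
move=> hy hm yk; rewrite -[RHS](minn_idPr yk) /scan.
elim: k {yk} => [|k IH]; rewrite ?min0n // iterS IH.
have [ky|yk] := ltnP k y.
  by have [v ->] := hm _ ky; rewrite (minn_idPl ky).
by rewrite hy (minn_idPr (leqW yk)).
Qed.

(** The value of [c] on [x] when every unbounded search is cut off after [t]
    steps. *)
Fixpoint run (c : code) (t x : nat) : option nat :=
  match c with
  | CZero => Some 0
  | CSucc => Some x.+1
  | CFst => Some (fstn x)
  | CSnd => Some (sndn x)
  | CPair f g =>
      obind (fun u => obind (fun v => Some (pairn u v)) (run g t x)) (run f t x)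
  | CComp f g => obind (run f t) (run g t x)
  | CPrec f g => nat_rec (fun=> option nat) (run f t (fstn x))
      (fun n o => obind (fun y => run g t (pairn (fstn x) (pairn n y))) o)
      (sndn x)
  | CMu f =>
      let m := scan (fun m => run f t (pairn x m)) t in
      if run f t (pairn x m) is Some 0 then Some m else None
  end.

(** The cut-off matters only for [CMu], and there a result is returned only after checking that the
    test is zero at the final counter; [lt_scan] shows that all earlier tests were positive. *)
Lemma run_sound c t x y : run c t x = Some y -> eval c x y.
Proof.
elim: c x y => [||||f IHf g IHg|f IHf g IHg|f IHf g IHg|f IHf] x y /=;
  try by case.
- case Ef: (run f t x) => [u|] //=; case Eg: (run g t x) => [v|] //= [<-].
  by exists u, v; split=> //; [apply: IHf | apply: IHg].
- case Eg: (run g t x) => [u|] //= Ef.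
  by exists u; [apply: IHg | apply: IHf].
- elim: (sndn x) y => [|n IH] y /=; first exact: IHf.
  case E: (nat_rec _ _ _ n) => [u|] //= Eg.
  by exists u; [apply: IH | apply: IHg].
- set m := scan _ _ => Em.
  have [{}Em <-] : run f t (pairn x m) = Some 0 /\ m = y.
    by case: (run f _ _) Em => [[|?]|] // [].
  split=> [|j /lt_scan[v /IHf]]; first exact: IHf.
  by exists v.
Qed.

(** Asking for success at every [t] beyond [s] lets the bounds of subprograms be merged by [maxn],
    with no separate monotonicity argument. *)
Lemma run_complete c x y :
  eval c x y -> exists s, forall t, s <= t -> run c t x = Some y.
Proof.
elim: c x y => [||||f IHf g IHg|f IHf g IHg|f IHf g IHg|f IHf] x y /=;
  try by move=> ->; exists 0.
- move=> [u [v [/IHf[s hs] /IHg[s' hs'] ->]]]; exists (maxn s s') => t.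
  by rewrite geq_max => /andP[/hs-> /hs'->].
- move=> [u /IHg[s hs] /IHf[s' hs']]; exists (maxn s s') => t.
  by rewrite geq_max => /andP[/hs-> /hs' /=].
- elim: (sndn x) y => [|n IH] y /=; first exact: IHf.
  move=> [u /IH[s hs] /IHg[s' hs']]; exists (maxn s s') => t.
  by rewrite geq_max => /andP[/hs-> /hs' /=].
- move=> [/IHf[s hs] hm].
  (* One bound must serve all the finitely many tests below [y]; it is built by induction on [y]. *)
  have {hm} [s' hs'] : exists s', forall t, s' <= t ->
      forall m, m < y -> exists v, run f t (pairn x m) = Some v.+1.
    elim: y hm {hs} => [|y IH] hm; first by exists 0.
    have [m my|s1 h1] := IH; first by apply: hm; apply: ltnW.
    have [v /IHf[s2 h2]] := hm _ (leqnn _).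
    exists (maxn s1 s2) => t; rewrite geq_max => /andP[t1 t2] m.
    rewrite ltnS leq_eqVlt => /predU1P[->|]; last exact: h1.
    by exists v; apply: h2.
  exists (maxn y (maxn s s')) => t; rewrite !geq_max => /and3P[yt st st'].
  by rewrite (scan_stop (h := fun m => run f t (pairn x m)) (hs _ st) (hs' _ st') yt) hs.
Qed.

Definition opt_code (o : option nat) : nat := if o is Some y then y.+1 else 0.

Lemma computable_bind (F : nat -> option nat) (K : nat -> nat -> option nat) :
    computable (fun x => opt_code (F x)) ->
    computable (fun z => opt_code (K (fstn z) (sndn z))) ->
  computable (fun x => opt_code (obind (K x) (F x))).
Proof.
move=> hF hK; apply: eq_computable (computable_case hF (computable_const 0) hK).
by move=> x /=; case: (F x) => [y|] //=; rewrite !pairnE.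
Qed.

Lemma computable_opt_comp (F : nat -> nat -> option nat) f g :
    computable (fun z => opt_code (F (fstn z) (sndn z))) ->
    computable f -> computable g ->
  computable (fun x => opt_code (F (f x) (g x))).
Proof.
move=> hF hf hg; apply: eq_computable (computable_comp hF (computable_pair hf hg)).
by move=> x /=; rewrite !pairnE.
Qed.

(** Induction on the program, with input [pairn t x]: [CPrec] becomes a recursion on option codes,
    and [CMu] a recursion of length [t] that simulates [scan]. *)
Lemma computable_run c : computable (fun z => opt_code (run c (fstn z) (sndn z))).
Proof.
have h1 := computable_fst; have h2 := computable_snd; have hS := computable_succ.
have h11 := computable_comp h1 h1; have h12 := computable_comp h1 h2.
have h21 := computable_comp h2 h1; have h22 := computable_comp h2 h2.
elim: c => [||||f IHf g IHg|f IHf g IHg|f IHf g IHg|f IHf] /=.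
- exact: computable_const.
- exact: (computable_comp hS (computable_comp hS h2)).
- exact: (computable_comp hS h12).
- exact: (computable_comp hS h22).
- apply: (computable_bind (K := fun z u => obind (fun v => Some (pairn u v))
    (run g (fstn z) (sndn z)))) => //.
  apply: (computable_bind (K := fun w v => Some (pairn (sndn w) v))).
    exact: computable_opt_comp h11 h21.
  exact: (computable_comp hS (computable_pair h21 h2)).
- apply: (computable_bind (K := fun z => run f (fstn z))) => //.
  exact: computable_opt_comp h11 h2.
- have ha : computable (fun z => opt_code (run f (fstn z) (fstn (sndn z)))).
    exact: computable_opt_comp IHf h1 h12.
  (* Here [w] is [pairn z (pairn m o)]: [z] is the original input [pairn t x], [m] the recursion
     counter and [o] the code of the previous value, decoded to [y]. *)
  pose K w y :=
    run g (fstn (fstn w)) (pairn (fstn (sndn (fstn w))) (pairn (fstn (sndn w)) y)).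
  have hK : computable (fun v => opt_code (K (fstn v) (sndn v))).
    apply: (computable_opt_comp IHg (computable_comp h1 h11)).
    apply: computable_pair (computable_comp h12 h11) _.
    by apply: computable_pair h2; apply: computable_comp h12 h1.
  have hb : computable (fun w =>
      if sndn (sndn w) is y.+1 then
        (fun v => opt_code (K (fstn v) (sndn v))) (pairn w y)
      else 0).
    exact: (computable_case h22 (computable_const 0) hK).
  apply: eq_computable (computable_rec h22 ha hb) => z.
  elim: (sndn (sndn z)) => [|n IH] //=.
  rewrite pairnE sndn_pairn IH.
  by case: (nat_rec _ _ _ n) => [y|] //=; rewrite /K !pairnE.
- pose test x m := opt_code (run f (fstn x) (pairn (sndn x) m)).
  have htest g h : computable g -> computable h ->
      computable (fun x => test (g x) (h x)).
    move=> hg hh; apply: (computable_opt_comp IHf (computable_comp h1 hg)).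
    exact: (computable_pair (computable_comp h2 hg) hh).
  (* A [test] value of 0 means undefined and 1 means the value zero, so its predecessor is positive
     exactly when the search must go on. *)
  have hb : computable (fun w => if (test (fstn w) (sndn (sndn w))).-1 is _.+1
      then (sndn (sndn w)).+1 else sndn (sndn w)).
    apply: (computable_if _ h22 (computable_comp hS h22)).
    exact: (computable_comp computable_pred (htest _ _ h1 h22)).
  have hm := computable_rec h1 (computable_const 0) hb.
  have hr := htest _ _ computable_id hm.
  apply: eq_computable (computable_if hr (computable_const 0)
    (computable_if (computable_comp computable_pred hr)
       (computable_comp hS hm) (computable_const 0))) => z /=.
  set m := scan _ _; set m' := nat_rec _ _ _ _.
  have -> : m = m'.
    rewrite /m /m' /scan; elim: {1 3}(fstn z) => [|k IH] //=.
    rewrite !pairnE IH /test.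
    by case: (run f _ _) => [[|v]|].
  by rewrite /test; case: (run f _ _) => [[|v]|].
Qed.

(** * Domains of programs and the recursion theorem *)

Notation halts c := (defined (eval c)).

Lemma halts_comp c f :
  computable f -> exists d, forall x, halts d x <-> halts c (f x).
Proof.
move=> [cf hf]; exists (CComp c cf) => x; split=> [[y [u /hf->]]|[y hy]].
  by exists y.
by exists y, (f x) => //; apply/hf.
Qed.

Lemma halts_and c d :
  exists e, forall x, halts e x <-> halts c x /\ halts d x.
Proof.
exists (CPair c d) => x; split=> [[y [u [v [hu hv _]]]]|[[u hu] [v hv]]].
  by split; [exists u | exists v].
by exists (pairn u v), u, v.
Qed.

(** As [f] is total, the search by [CMu] cannot get stuck before the least zero. *)
Lemma halts_exists_zero f : computable f ->
  exists c, forall x, halts c x <-> exists t, f (pairn x t) = 0.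
Proof.
move=> [c hc]; exists (CMu c) => x; split=> [[y [/hc hy _]]|[t ht]].
  by exists y.
have ex : exists t, f (pairn x t) == 0 by exists t; apply/eqP.
case: (ex_minnP ex) => m /eqP hm min; exists m; split; first exact/hc.
move=> k km; exists (f (pairn x k)).-1; apply/hc; rewrite prednK // lt0n.
by apply: contraL km => /min; rewrite -leqNgt.
Qed.

Lemma halts_run c x : halts c x <-> exists t, run c t x.
Proof.
split=> [[y /run_complete[t ht]]|[t]]; first by exists t; rewrite ht.
by case E: (run c t x) => [y|] // _; exists y; apply: run_sound E.
Qed.

(** Running one program after the other could diverge on the first. Instead, search for a [t] at
    which one of the two cut-off runs succeeds. *)
Lemma halts_or c d :
  exists e, forall x, halts e x <-> halts c x \/ halts d x.
Proof.
have hrun c' := computable_opt_comp (computable_run c') computable_snd computable_fst.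
have [e he] := halts_exists_zero (computable_if (hrun c)
  (computable_if (hrun d) (computable_const 1) (computable_const 0)) (computable_const 0)).
exists e => x; rewrite he !halts_run; split.
  move=> [t]; rewrite !pairnE.
  case Ec: (run c t x) => [u|] /=; first by left; exists t; rewrite Ec.
  by case Ed: (run d t x) => [u|] //= _; right; exists t; rewrite Ed.
by case=> -[t ht]; exists t; rewrite !pairnE;
  case: (run c t x) ht => [?|] //=; case: (run d t x).
Qed.

Lemma W_encode c x : W (encode c) x <-> halts c x.
Proof.
split=> [[y [c' /encode_inj-> hy]]|[y hy]]; first by exists y.
by exists y, c.
Qed.

Lemma computable_encode_const : computable (fun k => encode (CConst k)).
Proof.
(* The 5 is the tag of [CComp] and the 1 is the code of [CSucc]. *)
have hb : computable (fun w => 5 + 4 * pairn 1 (sndn (sndn w))).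
  apply: (computable_add (computable_const 5)); apply: computable_muln.
  apply: (computable_pair (computable_const 1)).
  exact: computable_comp computable_snd computable_snd.
apply: eq_computable (computable_rec computable_id (computable_const 0) hb) => k.
by rewrite /=; elim: {2 3}k => [|m IH] //=; rewrite !pairnE IH.
Qed.

(** Kleene's argument: [spec d] runs [d] on its own code paired with the input. Choose [d] to run
    [c] on [pairn (s a) x] when given [pairn a x]; then [spec d] runs [c] on its own code
    [s (encode d)], which is the required [e]. *)
Lemma recursion_theorem c : exists e, forall x, W e x <-> halts c (pairn e x).
Proof.
have [i hi] := computable_id.
pose spec d := CComp d (CPair (CConst (encode d)) i).
(* [s a] is the code of [spec d] when [a] is the code of [d] *)
pose s a := 5 + 4 * pairn a (4 + 4 * pairn (encode (CConst a)) (encode i)).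
have hs : computable s.
  apply: (computable_add (computable_const 5)); apply: computable_muln.
  apply: (computable_pair computable_id).
  apply: (computable_add (computable_const 4)); apply: computable_muln.
  exact: computable_pair computable_encode_const (computable_const _).
have [d hd] := halts_comp c
  (computable_pair (computable_comp hs computable_fst) computable_snd).
exists (s (encode d)) => x.
have -> : s (encode d) = encode (spec d) by [].
rewrite W_encode.
have -> : halts (spec d) x <-> halts d (pairn (encode d) x).
  split=> [[y [_ [_ [v [/eval_const-> /hi-> ->]]] hy]]|[y hy]]; first by exists y.
  exists y, (pairn (encode d) x) => //; exists (encode d), x.
  by split=> //; [apply/eval_const | apply/hi].
by rewrite hd !pairnE.
Qed.

(** * Morphisms between marked groups and presentations *)

Lemma morph_mulg1 (G H : groupType) (f : G -> H) :
  {morph f : x y / (x * y)%g} -> f 1%g = 1%g.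
Proof. by move=> fM; apply: (@mulgI _ (f 1%g)); rewrite -fM !mulg1. Qed.

Lemma morph_mulgV (G H : groupType) (f : G -> H) :
  {morph f : x y / (x * y)%g} -> {morph f : x / (x^-1)%g}.
Proof.
move=> fM x; apply: (@mulgI _ (f x)).
by rewrite -fM !mulgV (morph_mulg1 fM).
Qed.

Lemma marked_iso_sym G H : marked_iso G H -> marked_iso H G.
Proof.
move=> [f [fM fS] [g fK gK]]; exists g; last by exists f.
split=> [x y|]; first by apply: (can_inj fK); rewrite fM !gK.
by rewrite -fS -map_comp map_id_in // => x _; apply: fK.
Qed.

Lemma marked_morphism_comp (G H K : markedGroup) (g : H -> K) (f : G -> H) :
  marked_morphism g -> marked_morphism f -> marked_morphism (g \o f).
Proof.
move=> [gM gS] [fM fS]; split=> [x y|]; first by rewrite /= fM gM.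
by rewrite map_comp fS gS.
Qed.

Lemma marked_iso_trans G H K :
  marked_iso G H -> marked_iso H K -> marked_iso G K.
Proof.
move=> [f fP fB] [g gP gB]; exists (g \o f); last exact: bij_comp.
exact: marked_morphism_comp.
Qed.

Lemma marked_morphism_rank (G H : markedGroup) (f : G -> H) :
  marked_morphism f -> mg_rank G = mg_rank H.
Proof. by move=> [_ /(congr1 size)]; rewrite size_map !size_tuple. Qed.

(** The marking fixes the images of the generators, hence those of their inverses and of all
    products. *)
Lemma marked_morphism_class n (R R' : set (word n)) f :
    @marked_morphism (presentation R) (presentation R') f ->
  forall w, f (pres_class R w) = pres_class R' w.
Proof.
move=> [fM fS]; have f1 := morph_mulg1 fM; have fV := morph_mulgV fM.
have fgen i : f (pres_class R [:: (i, false)]) = pres_class R' [:: (i, false)].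
  move: fS; rewrite /= -map_comp => /eq_in_map; apply.
  by rewrite mem_enum.
have inv (Q : set (word n)) i :
    pres_class Q [:: (i, true)] = ((pres_class Q [:: (i, false)])^-1)%g.
  apply: (@mulIg _ (pres_class Q [:: (i, false)])); rewrite mulVg.
  rewrite [LHS]pres_mulE; apply/pres_classP; exact: (pres_cancel Q (i, true)).
elim=> [|[i b] w IH]; first exact: f1.
rewrite -cat1s -!pres_mulE; transitivity (f (pres_class R [:: (i, b)]) * f (pres_class R w))%g.
  exact: fM.
rewrite IH; congr (_ * _)%g; case: b => //.
by rewrite !inv fV fgen.
Qed.

Lemma pres_eq_subset n (R R' : set (word n)) :
    (forall r, R r -> pres_eq R' r [::]) ->
  forall u v, pres_eq R u v -> pres_eq R' u v.
Proof.
move=> RR' u v; elim=> {u v}.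
- exact: pres_refl.
- by move=> u v _; apply: pres_sym.
- by move=> u v w _ uv _; apply: pres_trans uv.
- by move=> u u' v v' _ hu _ hv; apply: pres_cat.
- exact: pres_cancel.
- exact: RR'.
Qed.

(** The two relator sets generate the same congruence, so rereading a representative in the other
    quotient does not depend on its choice, and the two rereadings are mutually inverse. *)
Lemma presentation_iso n (R R' : set (word n)) :
    (forall r, R r -> pres_eq R' r [::]) ->
    (forall r, R' r -> pres_eq R r [::]) ->
  marked_iso (presentation R) (presentation R').
Proof.
move=> /pres_eq_subset sub /pres_eq_subset sub'.
pose f (Q Q' : set (word n)) (x : presented Q) := pres_class Q' (repr x).
have fE (Q Q' : set (word n)) : (forall u v, pres_eq Q u v -> pres_eq Q' u v) ->
    forall w, f Q Q' (pres_class Q w) = pres_class Q' w.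
  by move=> QQ' w; apply/pres_classP/QQ'/pres_repr.
have fK (Q Q' : set (word n)) : (forall u v, pres_eq Q' u v -> pres_eq Q u v) ->
    cancel (f Q Q') (f Q' Q).
  by move=> QQ' x; rewrite fE // pres_class_repr.
exists (f R R'); last by exists (f R' R); exact: fK.
split=> [x y|].
  rewrite -(pres_class_repr x) -(pres_class_repr y).
  have -> u v : (pres_class R u * pres_class R v)%g = pres_class R (u ++ v).
    exact: pres_mulE.
  by rewrite !fE // [RHS]pres_mulE.
by rewrite /= -map_comp; apply: eq_map => i /=; rewrite fE.
Qed.

(** The morphism sends the class of a word to the class of the same word, so each relator in [R] is
    already trivial modulo [R']. *)
Lemma marked_quotient_presentation_setU n (R R' : set (word n)) :
    marked_quotient (presentation R') (presentation R) ->
  marked_iso (presentation (R `|` R')%classic) (presentation R').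
Proof.
move=> [f /marked_morphism_class fE]; apply: presentation_iso => r.
  case=> [Rr|]; last exact: pres_rel.
  apply/pres_classP; rewrite -!fE; congr f.
  exact/pres_classP/pres_rel.
by move=> R'r; apply: pres_rel; right.
Qed.

(** * The self-referential presentation *)

Lemma nuRP_pairn n e : nuRP (pairn n e) = presentation (@theta n @` W e)%classic.
Proof. by rewrite /nuRP !pairnE. Qed.

Theorem lemma3 (G H : markedGroup)
    (hG : recursively_presented G) (hH : recursively_presented H)
    (hGH : strict_marked_quotient H G) :
  ~ exists F : nat -> nat -> Prop,
      partial_computable F /\
      forall p : nat,
        marked_iso (nuRP p) G \/ marked_iso (nuRP p) H ->
        (defined F p <-> marked_iso (nuRP p) G).
Proof.
move: hG hH hGH => [pG isoG] [pH isoH] [[q qP] nGH] [F [[cF hF] FP]].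
have [[fG fGP _] [fH fHP _]] := (isoG, isoH).
set n := fstn pG in fG fGP; pose g := sndn pG.
(* Marked morphisms preserve the rank, so the chosen presentation of [H] uses the same alphabet size
   [n] as that of [G]. *)
have [h isoh] : exists h, marked_iso (presentation (@theta n @` W h)%classic) H.
  exists (sndn pH); suff -> : n = fstn pH by [].
  rewrite -[n]/(mg_rank (nuRP pG)) -[fstn pH]/(mg_rank (nuRP pH)).
  by rewrite (marked_morphism_rank fGP) (marked_morphism_rank qP)
    (marked_morphism_rank fHP).
have [cg hg] := encode_surj g; have [ch hh] := encode_surj h.
(* On input [pairn a x], the program [c] built here halts iff [x] is in [W g], or [x] is in [W h]
   and [F] is defined at [pairn n a]. The recursion theorem then makes [a] the index of the
   resulting set. *)
have [c1 hc1] := halts_comp cg computable_snd.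
have [c2 hc2] := halts_comp ch computable_snd.
have [c3 hc3] := halts_comp cF (computable_pair (computable_const n) computable_fst).
have [c4 hc4] := halts_and c2 c3.
have [c hc] := halts_or c1 c4.
have [e he] := recursion_theorem c.
have We x :
    W e x <-> W g x \/ W h x /\ defined F (pairn n e).
  rewrite he hc hc1 hc4 hc2 hc3 !pairnE -hg -hh !W_encode.
  suff -> : halts cF (pairn n e) <-> defined F (pairn n e) by [].
  by split=> -[y /hF hy]; exists y.
have := FP (pairn n e); rewrite nuRP_pairn.
have [Fdef|Fndef] := pselect (defined F (pairn n e)).
- have -> : W e = (W g `|` W h)%classic.
    by apply/seteqP; split=> x; [move=> /We[]|case=> ?; apply/We];
      [left | move=> []; right | left | right].
  rewrite image_setU => FPe.
  have isoU : marked_iso (presentation (theta n @` W g `|` theta n @` W h)%classic) H.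
    apply: (marked_iso_trans _ isoh); apply: marked_quotient_presentation_setU.
    (* The presentation with relators from [W g] is [nuRP pG] itself, so the quotient map is the
       composite through [G] and [H]. *)
    have [k kP _] := marked_iso_sym isoh.
    exists (k \o (q \o fG)).
    by apply: marked_morphism_comp kP _; apply: marked_morphism_comp qP _.
  (* Since [F] halts, the same presentation must also define [G], making [G] and [H] isomorphic
     against strictness. *)
  have isoUG := (FPe (or_intror isoU)).1 Fdef.
  exact/nGH/(marked_iso_trans (marked_iso_sym isoUG)).
(* If [F] diverges, the presentation is that of [G], on which [F] has to halt. *)
- have -> : W e = W g.
    by apply/seteqP; split=> x; [move=> /We[|[]]|move=> ?; apply/We; left].
  by move=> FPe; apply: Fndef; exact: (FPe (or_introl isoG)).2 isoG.
Qed.
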